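(* Let $p>2$ be a prime, $\mathbf{F}$ a field of characteristic $p$, and $m,\ell\ge 0$ integers. Choose a basis $\{X_i,Y_i\mid i=1,\ldots,m\}\cup\{X_i,Y_i,Z_i\mid i=m+1,\ldots,m+\ell\}$ of $(mV_2\oplus \ell V_3)^*$ with $\Delta(Z_i)=Y_i$ (for $i>m$), $\Delta(Y_i)=X_i$ and $\Delta(X_i)=0$. For $m<i\le m+\ell$ let $d_i:=Y_i^2-X_i(Y_i+2Z_i)$ and for $m<i<j\le m+\ell$ let $w_{ij}:=Z_iX_j-Y_iY_j+X_iZ_j+X_iY_j$. Let $I$ be the ideal of $\mathbf{F}[mV_2\oplus\ell V_3]$ generated by $$\{X_i,N(Y_i)\mid i=1,\ldots, m\}\cup\{X_i,d_i,N(Z_i)\mid i=m+1,\ldots,m+\ell\}\cup\{w_{ij}\mid m<i<j\le m+\ell\}.$$ Then $I$ coincides with the Hilbert ideal of $mV_2\oplus \ell V_3$.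
   Context: For $n\le p$, $V_n$ is the $n$-dimensional indecomposable representation over $\mathbf{F}$ of the cyclic group $\mathbf{Z}/p=\langle\sigma\rangle$ on which $\sigma$ acts by a single Jordan block with eigenvalue $1$; $mV_n$ is the direct sum of $m$ copies. For a representation $V$, the action on $V^*$ extends to algebra automorphisms of $\mathbf{F}[V]=S(V^* )$; $\Delta:=\sigma-1$. For a non-invariant $\varphi\in V^*$, $N(\varphi):=\prod_{i=1}^p\sigma^i(\varphi)$. The Hilbert ideal is the ideal of $\mathbf{F}[V]$ generated by all homogeneous invariants of positive degree. *)

(* Defs.v *)
From HB Require Import structures.
From mathcomp Require Export all_boot all_order all_algebra.
From mathcomp Require Export mpoly.

Set Implicit Arguments.
Unset Strict Implicit.
Unset Printing Implicit Defensive.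

Import GRing.Theory.
Local Open Scope ring_scope.

(* A representation of Z/p = <sigma> on V = 'cV[F]_n is given by the matrix A
   of sigma, v |-> A *m v.  V^* is 'rV[F]_n, a row u being the linear form
   v |-> u *m v, so that sigma acts on V^* by u |-> u *m A^-1.  F[V] = S(V^* )
   is {mpoly F[n]}, 'X_k being the k-th coordinate function. *)
Section Representation.

Variables (F : fieldType) (n : nat).

Definition linform (u : 'rV[F]_n) : {mpoly F[n]} := \sum_k u 0 k *: 'X_k.

Variable A : 'M[F]_n.

Definition sigma_dual (u : 'rV[F]_n) : 'rV[F]_n := u *m invmx A.

Definition Delta_dual (u : 'rV[F]_n) : 'rV[F]_n := sigma_dual u - u.

Definition sigma (f : {mpoly F[n]}) : {mpoly F[n]} :=
  f \mPo [tuple linform (sigma_dual (delta_mx 0 k)) | k < n].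

Lemma sigma_linform u : sigma (linform u) = linform (sigma_dual u).
Proof.
rewrite /sigma {1}/linform raddf_sum /=.
under eq_bigr => k _ do rewrite comp_mpolyZ comp_mpolyXU -tnth_nth tnth_mktuple.
rewrite /linform; under eq_bigr => k _ do rewrite scaler_sumr.
rewrite exchange_big /=; apply: eq_bigr => j _.
under eq_bigr => k _ do rewrite scalerA.
rewrite -scaler_suml /sigma_dual mxE; congr (_ *: _); apply: eq_bigr => k _.
by rewrite -rowE mxE.
Qed.

Definition invariant (f : {mpoly F[n]}) : Prop :=
  forall k : nat, iter k sigma f = f.

Definition orbit_norm (p : nat) (f : {mpoly F[n]}) : {mpoly F[n]} :=
  \prod_(1 <= i < p.+1) iter i sigma f.

End Representation.

Definition ideal_gen (R : comNzRingType) (S : R -> Prop) (f : R) : Prop :=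
  exists s : seq (R * R),
    (forall c, c \in s -> S c.2) /\ f = \sum_(c <- s) c.1 * c.2.

Definition hilbert_ideal (F : fieldType) (n : nat) (A : 'M[F]_n) :
    {mpoly F[n]} -> Prop :=
  ideal_gen (fun f => invariant A f /\
                      exists d : nat, (0 < d)%N /\ f \is d.-homog).

(* The action of sigma on V_n. *)
Definition jordan_block (F : fieldType) (n : nat) : 'M[F]_n :=
  \matrix_(i, j) ((i == j) || (i.+1 == j :> nat))%:R.

(* m V_2 + l V_3: the first m of the m + l Jordan blocks have size 2, the
   other l have size 3. *)
Definition block_dim (m l : nat) (i : 'I_(m + l)) : nat :=
  if (i < m)%N then 2 else 3.

Definition rep_dim (m l : nat) : nat := (\sum_i block_dim (m := m) (l := l) i)%N.

Definition mV2_lV3 (F : fieldType) (m l : nat) : 'M[F]_(rep_dim m l) :=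
  \mxdiag_i jordan_block F (block_dim (m := m) (l := l) i).

(* Indices are shifted: X i, Y i for i : 'I_(m + l), and Z j for j : 'I_l
   is the variable Z_i attached to i = rshift m j. *)
Section Generators.

Variables (F : fieldType) (m l n : nat) (p : nat) (A : 'M[F]_n).
Variables (X Y : 'I_(m + l) -> {mpoly F[n]}) (Z : 'I_l -> {mpoly F[n]}).

Definition d_poly (j : 'I_l) : {mpoly F[n]} :=
  Y (rshift m j) ^+ 2 - X (rshift m j) * (Y (rshift m j) + 2%:R * Z j).

Definition w_poly (i j : 'I_l) : {mpoly F[n]} :=
  Z i * X (rshift m j) - Y (rshift m i) * Y (rshift m j)
  + X (rshift m i) * Z j + X (rshift m i) * Y (rshift m j).

Inductive generator : {mpoly F[n]} -> Prop :=
| gen_X2 (i : 'I_m) : generator (X (lshift l i))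
| gen_NY (i : 'I_m) : generator (orbit_norm A p (Y (lshift l i)))
| gen_X3 (j : 'I_l) : generator (X (rshift m j))
| gen_d (j : 'I_l) : generator (d_poly j)
| gen_NZ (j : 'I_l) : generator (orbit_norm A p (Z j))
| gen_w (i j : 'I_l) : (i < j)%N -> generator (w_poly i j).

End Generators.

(* Main.v *)
(* In the coordinates X, Y, Z, sigma is an invertible linear substitution
   fixing each X and mapping Y to Y + X and Z to Z + Y.  Let kappa set to 0 the
   variables that occur as a shift, i.e. the X's and the Y's of the V_3
   summands, so that kappa sigma = kappa.  If g is invariant and the variable v
   is the shift of u, differentiating sigma g = g along v and applying kappa
   gives kappa (d_v g) = kappa (d_v g + d_u g), hence kappa (d_u g) = 0.
   Therefore no monomial u * N occurs in g when N avoids the killed variables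
   and p does not divide the exponent of u.  Every other monomial of positive
   degree is divisible by some X, by Y_i ^ p (i <= m), by Z_j ^ p, or by
   Y_j * Y_k (j, k > m).  These belong to the ideal: modulo the X's, d_j and
   w_jk are Y_j ^ 2 and - Y_j * Y_k, N(Y_i) is Y_i ^ p, and N(Z_j) is
   Z_j ^ p + C(p + 1, 2) Z_j ^ (p - 1) Y_j modulo Y_j ^ 2, where p divides
   C(p + 1, 2) as p > 2. *)

From HB Require Import structures.
From mathcomp Require Import ring.
Require Import Defs.

Set Implicit Arguments.
Unset Strict Implicit.
Unset Printing Implicit Defensive.

Import GRing.Theory.
Local Open Scope ring_scope.

(** * Ideals generated by a set *)

Section IdealGen.

Variables (R : comNzRingType) (S : R -> Prop).

Local Notation I := (ideal_gen S).

Lemma ideal_gen_mem x : S x -> I x.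
Proof.
move=> Sx; exists [:: (1, x)]; split=> [c|]; last by rewrite big_seq1 mul1r.
by rewrite inE => /eqP ->.
Qed.

Lemma ideal_gen0 : I 0.
Proof. by exists [::]; split=> //; rewrite big_nil. Qed.

Lemma ideal_genD x y : I x -> I y -> I (x + y).
Proof.
move=> [s [Ss ->]] [t [St ->]]; exists (s ++ t); split; last by rewrite big_cat.
by move=> c; rewrite mem_cat => /orP[/Ss|/St].
Qed.

Lemma ideal_genMl a x : I x -> I (a * x).
Proof.
move=> [s [Ss ->]]; exists [seq (a * c.1, c.2) | c <- s]; split.
  by move=> _ /mapP[c /Ss ? ->].
by rewrite big_map mulr_sumr; apply: eq_bigr => c _; rewrite mulrA.
Qed.

Lemma ideal_genMr a x : I x -> I (x * a).
Proof. by rewrite mulrC; apply: ideal_genMl. Qed.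

Lemma ideal_genB x y : I x -> I y -> I (x - y).
Proof. by move=> Ix Iy; rewrite -mulN1r; apply/ideal_genD/ideal_genMl. Qed.

Lemma ideal_gen_sum (J : eqType) (r : seq J) (G : J -> R) :
  (forall j, j \in r -> I (G j)) -> I (\sum_(j <- r) G j).
Proof.
move=> IG; rewrite big_seq; apply: big_ind => //.
- exact: ideal_gen0.
- exact: ideal_genD.
Qed.

(** Modulo [x] and [y ^+ 2] only the terms of degree at most 1 in [y] survive, and 1 + ... + (r + 1)
    = C(r + 2, 2). The factors have the shape of the iterates of [sigma] on [z]. *)
Lemma ideal_gen_prod_norm r x y z : I x -> I (y ^+ 2) ->
  I (\prod_(1 <= i < r.+2) (z + y *+ i + x *+ 'C(i, 2))
     - (z ^+ r.+1 + (z ^+ r * y) *+ 'C(r.+2, 2))).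
Proof.
move=> Ix Iyy; elim: r => [|r IHr].
  by rewrite big_nat1 expr0 expr1 mul1r binn bin_small // mulr1n mulr0n addr0
             subrr; apply: ideal_gen0.
rewrite big_nat_recr //=; move: IHr; set P := \prod_(_ <= _ < _) _.
rewrite (_ : 'C(r.+3, 2) = ('C(r.+2, 2) + r.+2)%N); last by rewrite binS bin1.
set c := 'C(r.+2, 2); set Q := z ^+ _ + _ => IHr.
(* The number [c] is both the coefficient of [z ^+ r * y] in [Q] and that of [x] in the new
   factor. *)
have -> : P * (z + y *+ r.+2 + x *+ c) -
    (z ^+ r.+2 + z ^+ r.+1 * y *+ (c + r.+2)) =
    (P - Q) * (z + y *+ r.+2 + x *+ c) +
    ((Q *+ c) * x + (z ^+ r *+ c *+ r.+2) * y ^+ 2).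
  rewrite /Q; clearbody c P; clear; rewrite !exprS.
  move: (z ^+ r) r.+2 => t e; ring.
by apply/ideal_genD/ideal_genD; [apply: ideal_genMr|apply: ideal_genMl..].
Qed.

End IdealGen.

Lemma ideal_gen_sub (R : comNzRingType) (S T : R -> Prop) :
  (forall x, S x -> ideal_gen T x) -> forall x, ideal_gen S x -> ideal_gen T x.
Proof.
move=> ST x [s [Ss ->]]; apply: ideal_gen_sum => c cs.
exact/ideal_genMl/ST/Ss.
Qed.

(** * Linear substitutions, derivatives and coefficients *)

Section LinearSubstitution.

Variables (F : fieldType) (n : nat).
Implicit Types (B C S : 'M[F]_n) (f g h : {mpoly F[n]}) (u : 'rV[F]_n).

(** The matrix is arbitrary, so that [sigma], changes of coordinates and the singular [kill] are all
    instances. *)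
Definition subst B f : {mpoly F[n]} :=
  f \mPo [tuple linform (row k B) | k < n].

Lemma mpoly_ring_ind (P : {mpoly F[n]} -> Prop) :
  (forall c, P c%:MP) -> (forall i, P 'X_i) ->
  (forall f g, P f -> P g -> P (f + g)) ->
  (forall f g, P f -> P g -> P (f * g)) -> forall f, P f.
Proof.
move=> PC PX PD PM; elim/mpolyind=> [|c m f _ _ Pf].
  by rewrite -mpolyC0; apply: PC.
apply: PD => //; rewrite -mul_mpolyC mpolyXE_id; apply: (PM) => //.
apply: big_ind => [|f' g'|i _]; [by rewrite -mpolyC1; apply: (PC)|exact: (PM)|].
elim: (m i) => [|k IHk]; first by rewrite expr0 -mpolyC1; apply: PC.
by rewrite exprS; apply: PM.
Qed.

Lemma linform_is_linear : linear (@linform F n).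
Proof.
move=> a u v; rewrite /linform scaler_sumr -big_split /=; apply: eq_bigr => k _.
by rewrite !mxE scalerDl scalerA.
Qed.

HB.instance Definition _ :=
  GRing.isLinear.Build F 'rV[F]_n {mpoly F[n]} _ (@linform F n)
    linform_is_linear.

Lemma linform_delta k : linform (delta_mx 0 k) = 'X_k :> {mpoly F[n]}.
Proof.
rewrite /linform (bigD1 k) //= big1 => [|j /negPf jk].
  by rewrite addr0 mxE !eqxx scale1r.
by rewrite mxE eqxx jk scale0r.
Qed.

Lemma substX B k : subst B 'X_k = linform (row k B).
Proof. by rewrite /subst comp_mpolyXU -tnth_nth tnth_mktuple. Qed.

Lemma subst_linform B u : subst B (linform u) = linform (u *m B).
Proof.
rewrite {1}/linform /subst raddf_sum /=.
under eq_bigr => k _ do rewrite comp_mpolyZ -/(subst B _) substX.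
rewrite mulmx_sum_row raddf_sum; apply: eq_bigr => k _.
by rewrite /= linearZ.
Qed.

Lemma substD B : {morph subst B : f g / f + g}.
Proof. exact: comp_mpolyD. Qed.

Lemma substM B : {morph subst B : f g / f * g}.
Proof. by move=> f g; rewrite /subst rmorphM. Qed.

Lemma substC B c : subst B c%:MP = c%:MP.
Proof. exact: comp_mpolyC. Qed.

Lemma subst_subst B C f : subst B (subst C f) = subst (C *m B) f.
Proof.
elim/mpoly_ring_ind: f => [c|i|f g IHf IHg|f g IHf IHg].
- by rewrite !substC.
- by rewrite !substX subst_linform row_mul.
- by rewrite !substD IHf IHg.
- by rewrite !substM IHf IHg.
Qed.

Lemma subst1 f : subst 1%:M f = f.
Proof.
elim/mpoly_ring_ind: f => [c|i|f g IHf IHg|f g IHf IHg].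
- by rewrite substC.
- by rewrite substX row1 linform_delta.
- by rewrite substD IHf IHg.
- by rewrite substM IHf IHg.
Qed.

Lemma sigmaE A f : sigma A f = subst (invmx A) f.
Proof.
by congr (_ \mPo _); apply: eq_from_tnth => k; rewrite !tnth_mktuple rowE.
Qed.

Lemma mderivXU v k : ('X_k : {mpoly F[n]})^`M(v) = (k == v)%:R%:MP.
Proof.
rewrite mderivX mnm1E; case: eqP => [->|_]; last by rewrite scale0r mpolyC0.
rewrite scale1r (_ : (U_(v) - U_(v))%MM = 0%MM) ?mpolyX0 ?mpolyC1 //.
by apply/mnmP => i; rewrite mnmBE subnn mnm0E.
Qed.

Lemma mderiv_linform v u : (linform u)^`M(v) = (u 0 v)%:MP.
Proof.
rewrite /linform raddf_sum (bigD1 v) //= big1 => [|k /negPf kv].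
  by rewrite addr0 mderivZ mderivXU eqxx -mul_mpolyC mulr1.
by rewrite mderivZ mderivXU kv mpolyC0 scaler0.
Qed.

(** Chain rule: [S k v] is the derivative along [v] of the image of ['X_k]. *)
Lemma mderiv_subst S v f :
  (subst S f)^`M(v) = \sum_k S k v *: subst S f^`M(k).
Proof.
elim/mpoly_ring_ind: f => [c|i|f g IHf IHg|f g IHf IHg].
- rewrite substC mderivC big1 // => k _.
  by rewrite mderivC -mpolyC0 substC mpolyC0 scaler0.
- rewrite substX mderiv_linform mxE (bigD1 i) //= big1 => [|k /negPf ki].
  + by rewrite addr0 mderivXU eqxx substC -mul_mpolyC mulr1.
  + by rewrite mderivXU eq_sym ki substC mpolyC0 scaler0.
- rewrite substD mderivD IHf IHg -big_split /=; apply: eq_bigr => k _.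
  by rewrite mderivD substD scalerDr.
- rewrite substM mderivM IHf IHg mulr_suml mulr_sumr -big_split /=.
  apply: eq_bigr => k _.
  by rewrite mderivM substD !substM scalerDr -scalerAl -scalerAr.
Qed.

Lemma coeff0_subst B f : (subst B f)@_0 = f@_0.
Proof.
have X0 i : ('X_i : {mpoly F[n]})@_0 = 0.
  rewrite mcoeffX; case: eqP => // /mnmP/(_ i).
  by rewrite mnm1E eqxx mnm0E.
elim/mpoly_ring_ind: f => [c|i|f g IHf IHg|f g IHf IHg].
- by rewrite substC.
- rewrite substX X0 /linform raddf_sum /= big1 // => k _.
  by rewrite mcoeffZ X0 mulr0.
- by rewrite substD !mcoeffD IHf IHg.
- by rewrite substM !rmorphM /= IHf IHg.
Qed.

(** The matrix of kappa, [K] being the set of killed variables. *)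
Definition kill (K : {pred 'I_n}) : 'M[F]_n :=
  diag_mx (\row_k (k \notin K)%:R).

Lemma mcoeff_subst_kill (K : {pred 'I_n}) f (m : 'X_{1..n}) :
  (forall k, k \in K -> m k = 0%N) -> (subst (kill K) f)@_m = f@_m.
Proof.
move=> mK; elim/mpolyind: f => [|c m' f _ _ IHf].
  by rewrite -mpolyC0 substC.
rewrite -mul_mpolyC substD substM substC !mcoeffD {}IHf; congr (_ + _).
rewrite !mul_mpolyC !mcoeffZ; congr (_ * _).
rewrite /subst comp_mpolyX.
rewrite (eq_bigr (fun k => ((k \notin K)%:R ^+ m' k)%:MP * 'X_k ^+ m' k)).
  rewrite big_split /= -mpolyXE_id -rmorph_prod /= mul_mpolyC mcoeffZ mcoeffX.
  case: eqP => [->|_]; last by rewrite !mulr0.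
  rewrite mulr1 big1 // => k _.
  by case: (boolP (k \in K)) => [/mK ->|_]; rewrite ?expr0 ?expr1n.
move=> k _; rewrite tnth_mktuple rmorphXn -exprMn; congr (_ ^+ _).
rewrite row_diag_mx mxE linearZ /= linform_delta.
by rewrite mul_mpolyC.
Qed.

(** The derivative argument, with [v] the shift of [u]: [S] alters variables by killed ones only,
    and ['X_v] enters only the images of ['X_v] and ['X_u]. *)
Lemma subst_fixed_coeff S (K : {pred 'I_n}) g (u v : 'I_n) (m : 'X_{1..n}) :
  (forall k j, j \notin K -> S k j = (k == j)%:R) ->
  v \in K -> (forall k, S k v = (k == v)%:R + (k == u)%:R) ->
  subst S g = g -> (forall k, k \in K -> (m - U_(u))%MM k = 0%N) ->
  (m u)%:R != 0 :> F -> g@_m = 0.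
Proof.
move=> SK Kv Sv Sg mK mu0.
(* This is kappa sigma = kappa in matrix form. *)
have SD : S *m kill K = kill K.
  apply/matrixP=> k j; rewrite mul_mx_diag !mxE; case: (boolP (j \in K)) => Kj.
    by rewrite mulr0; case: eqP => [->|]; rewrite ?Kj ?mul0rn ?mulr0n.
  rewrite SK // mulr1; case: eqP => [->|] /=; first by rewrite Kj.
  by rewrite mulr0n.
have du0 : subst (kill K) g^`M(u) = 0.
  (* In the chain rule only the derivatives along [v] and [u] survive, and the one along [v] cancels
     against the right-hand side. *)
  have := congr1 (fun h => subst (kill K) h^`M(v)) Sg.
  rewrite /= mderiv_subst.
  under eq_bigr => k _ do rewrite Sv scalerDl.
  rewrite big_split /= (bigD1 v) //= big1 ?addr0 => [|k /negPf->]; last first.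
    by rewrite scale0r.
  rewrite (bigD1 u) //= big1 ?addr0 => [|k /negPf->]; last by rewrite scale0r.
  rewrite !eqxx !scale1r substD !subst_subst !SD.
  by rewrite -[RHS]addr0 => /addrI.
have mu : (0 < m u)%N by rewrite lt0n; apply: contraNneq mu0 => ->.
have le_um : (U_(u) <= m)%MM.
  by apply/mnm_lepP=> i; rewrite mnm1E; case: eqP => // <-.
(* The coefficient of the derivative at [m - U_(u)] is [m u] times that of [g] at [m]. *)
have := mcoeff_subst_kill (g^`M(u)) mK.
rewrite du0 mcoeff0 mcoeff_deriv submK // mnmBE mnm1E eqxx subn1 prednK //.
by move/esym/eqP; rewrite -mulr_natr mulf_eq0 (negPf mu0) orbF => /eqP.
Qed.

End LinearSubstitution.

(** Numbering the labels by [h] allows the basis to serve as coordinates. *)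
Lemma basis_rows_unit (F : fieldType) (n : nat) (T : finType)
    (b : T -> 'rV[F]_n) :
  basis_of fullv (codom b) ->
  exists2 h : T -> 'I_n, bijective h &
  exists2 E : 'M[F]_n, E \in unitmx & forall t, row (h t) E = b t.
Proof.
move=> b_basis.
have cardT : #|T| = n.
  have := vector.size_basis (X := in_tuple (codom b)) b_basis.
  rewrite size_codom => <-.
  by rewrite dimvf /dim /= mul1n.
pose h t := cast_ord cardT (enum_rank t).
pose h' k := enum_val (cast_ord (esym cardT) k).
have hK : cancel h h' by move=> t; rewrite /h /h' cast_ordK enum_rankK.
have h'K : cancel h' h by move=> k; rewrite /h /h' enum_valK cast_ordKV.
exists h; first by exists h'.
exists (\matrix_k b (h' k)) => [|t]; last by rewrite rowK hK.
rewrite -row_full_unit -sub1mx; apply/row_subP => i.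
have : row i 1%:M \in <<codom b>>%VS by rewrite (span_basis b_basis) memvf.
move/(@coord_span _ _ _ (in_tuple _)) ->; apply: summx_sub => j _.
apply: scalemx_sub.
have /codomP[t ->] : (codom b)`_j \in codom b by apply: mem_nth.
by rewrite -{1}(hK t) -(rowK (fun k => b (h' k))) row_sub.
Qed.

Lemma codom_sum (T1 T2 : finType) (T : Type) (f : T1 + T2 -> T) :
  codom f = codom (f \o inl) ++ codom (f \o inr).
Proof. by rewrite !codomE !enumT [in LHS]unlock map_cat -!map_comp. Qed.

(** * Iterates of [sigma] and orbit norms *)

Section Orbits.

Variables (F : fieldType) (n : nat) (A : 'M[F]_n).

Lemma sigma_dualE u : sigma_dual A u = u + Delta_dual A u.
Proof. by rewrite /Delta_dual addrC subrK. Qed.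

(** Binomial expansion of (1 + Delta)^k, cut off because Delta^3 z = 0. *)
Lemma iter_sigma_dual x y z k :
  Delta_dual A z = y -> Delta_dual A y = x -> Delta_dual A x = 0 ->
  iter k (sigma_dual A) z = z + y *+ k + x *+ 'C(k, 2).
Proof.
move=> Dz Dy Dx; elim: k => [|k IHk]; first by rewrite bin0n !mulr0n !addr0.
rewrite iterS IHk -!scaler_nat /sigma_dual !mulmxDl -!scalemxAl.
rewrite -!/(sigma_dual A _) !scaler_nat.
rewrite !sigma_dualE Dz Dy Dx addr0 binS bin1 mulrnDr mulrnDl mulrS.
by rewrite -!addrA; do 3!congr (_ + _); rewrite addrC.
Qed.

Lemma iter_sigma_linform k u :
  iter k (sigma A) (linform u) = linform (iter k (sigma_dual A) u).
Proof. by elim: k => //= k ->; rewrite sigma_linform. Qed.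

Lemma invariant_sigma f : sigma A f = f -> invariant A f.
Proof. by move=> sf; elim=> //= k ->. Qed.

(** The factors are permuted cyclically by [sigma]. *)
Lemma orbit_norm_invariant p f :
  (0 < p)%N -> iter p (sigma A) f = f -> invariant A (orbit_norm A p f).
Proof.
move=> p0 sf; apply: invariant_sigma; rewrite {1}/sigma rmorph_prod /=.
under eq_bigr => i _ do rewrite -/(sigma A _) -iterS.
(* The last factor sigma^(p + 1) f equals sigma f, the first factor of the norm. *)
rewrite big_nat_recr //= sf /orbit_norm [RHS]big_ltn // [in RHS]big_add1.
by rewrite mulrC.
Qed.

Lemma linform_homog (u : 'rV[F]_n) : linform u \is 1.-homog.
Proof.
by apply: rpred_sum => k _; rewrite rpredZ // dhomogX; apply/eqP/mdeg1.
Qed.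

Lemma orbit_norm_homog p u : orbit_norm A p (linform u) \is p.-homog.
Proof.
rewrite /orbit_norm; elim: p => [|p IHp]; first by rewrite big_nil dhomog1.
rewrite big_nat_recr // iter_sigma_linform.
by rewrite -[p.+1 in X in _ \is X]addn1; apply/dhomogM/linform_homog.
Qed.

End Orbits.

(** * The basis X, Y, Z and the invariance of the generators *)

Section HilbertIdeal.

Variables (p : nat) (F : fieldType) (m l n : nat) (A : 'M[F]_n).
Variables (X Y : 'I_(m + l) -> 'rV[F]_n) (Z : 'I_l -> 'rV[F]_n).
Hypotheses (p_prime : prime p) (p_gt2 : (2 < p)%N) (charF : p \in [pchar F]).
Hypothesis XYZ_basis : basis_of fullv (codom X ++ codom Y ++ codom Z).
Hypothesis Delta_Z : forall j, Delta_dual A (Z j) = Y (rshift m j).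
Hypothesis Delta_Y : forall i, Delta_dual A (Y i) = X i.
Hypothesis Delta_X : forall i, Delta_dual A (X i) = 0.

Local Notation lX i := (linform (X i)).
Local Notation lY i := (linform (Y i)).
Local Notation lZ j := (linform (Z j)).
Local Notation gens :=
  (generator p A (fun i => lX i) (fun i => lY i) (fun j => lZ j)).
Local Notation I := (ideal_gen gens).

Lemma mulrn_pchar_eq0 (V : lmodType F) (v : V) k : (p %| k)%N -> v *+ k = 0.
Proof.
by rewrite -scaler_nat (dvdn_pcharf charF) => /eqP ->; rewrite scale0r.
Qed.

(** Here p > 2 enters; this gives sigma^p = 1 on the chains Z, Y, X and p | C(p + 1, 2). *)
Lemma dvdp_bin2 : (p %| 'C(p, 2))%N.
Proof. exact: prime_dvd_bin. Qed.

Lemma sigma_pow_p x y z :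
  Delta_dual A z = y -> Delta_dual A y = x -> Delta_dual A x = 0 ->
  iter p (sigma A) (linform z) = linform z.
Proof.
move=> Dz Dy Dx; rewrite iter_sigma_linform (iter_sigma_dual _ Dz Dy Dx).
by rewrite !mulrn_pchar_eq0 ?dvdp_bin2 // !addr0.
Qed.

Lemma sigma_X i : sigma A (lX i) = lX i.
Proof. by rewrite sigma_linform sigma_dualE Delta_X addr0. Qed.

Lemma sigma_Y i : sigma A (lY i) = lY i + lX i.
Proof. by rewrite sigma_linform sigma_dualE Delta_Y raddfD. Qed.

Lemma sigma_Z j : sigma A (lZ j) = lZ j + lY (rshift m j).
Proof. by rewrite sigma_linform sigma_dualE Delta_Z raddfD. Qed.

Lemma Delta_dual0 : Delta_dual A 0 = 0.
Proof. by rewrite /Delta_dual /sigma_dual mul0mx subr0. Qed.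

(** The easy inclusion: norms are invariant because sigma^p fixes their argument, [d_poly] and
    [w_poly] by direct expansion. *)
Lemma generator_invariant f :
  gens f -> invariant A f /\ exists d : nat, (0 < d)%N /\ f \is d.-homog.
Proof.
have hM (u v : 'rV[F]_n) : linform u * linform v \is 2.-homog.
  by apply: (@dhomogM _ _ _ 1 _ 1); apply: linform_homog.
have p_gt0 := prime_gt0 p_prime.
case=> [i|i|j|j|j|i j _].
- split; last by exists 1%N; rewrite linform_homog.
  exact/invariant_sigma/sigma_X.
- split; last by exists p; rewrite orbit_norm_homog.
  (* The chain z, y, x is here Y, X, 0. *)
  exact/orbit_norm_invariant/(sigma_pow_p (Delta_Y _) (Delta_X _))/Delta_dual0.
- split; last by exists 1%N; rewrite linform_homog.
  exact/invariant_sigma/sigma_X.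
- split.
    apply: invariant_sigma; rewrite /d_poly {1}/sigma.
    rewrite rmorphB rmorphXn rmorphM rmorphD rmorphM rmorph_nat /=.
    rewrite -!/(sigma A _) sigma_X sigma_Y sigma_Z; ring.
  exists 2%N; split=> //; rewrite /d_poly mulrDr mulrCA mulr_natl.
  by rewrite rpredB ?rpredD ?rpredMn ?expr2 //; exact: hM.
- split; last by exists p; rewrite orbit_norm_homog.
  exact/orbit_norm_invariant/(sigma_pow_p (Delta_Z _) (Delta_Y _) (Delta_X _)).
- split.
    apply: invariant_sigma; rewrite /w_poly {1}/sigma.
    rewrite !rmorphD rmorphN !rmorphM /=.
    rewrite -!/(sigma A _) !sigma_X !sigma_Y !sigma_Z; ring.
  by exists 2%N; split=> //; rewrite /w_poly !rpredD ?rpredN //; exact: hM.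
Qed.

(** * Monomials belonging to the ideal [I] *)

Lemma ideal_X i : I (lX i).
Proof.
case: (split_ordP i) => k ->; apply: ideal_gen_mem; first exact: gen_X2.
exact: gen_X3.
Qed.

Lemma ideal_YY j k : I (lY (rshift m j) * lY (rshift m k)).
Proof.
(* Generators [w_poly j k] exist for [j < k] only; the diagonal case comes from [d_poly]. *)
wlog le_jk: j k / (j <= k)%N.
  by move=> IH; case/orP: (leq_total j k) => /IH //; rewrite mulrC.
move: le_jk; rewrite leq_eqVlt => /orP[/eqP/val_inj <-|lt_jk].
  set Yj := lY _; set Xj := lX (rshift m j).
  have -> : Yj * Yj = d_poly (fun i => lX i) (fun i => lY i) (fun j => lZ j) j
      + (Yj + 2%:R * lZ j) * Xj by rewrite /d_poly; ring.
  apply/ideal_genD/ideal_genMl/ideal_X.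
  exact/ideal_gen_mem/gen_d.
set w := w_poly (fun i => lX i) (fun i => lY i) (fun j => lZ j) j k.
have -> : lY (rshift m j) * lY (rshift m k) =
    lZ j * lX (rshift m k) + (lZ k + lY (rshift m k)) * lX (rshift m j) - w.
  by rewrite /w /w_poly; ring.
apply: ideal_genB; last exact/ideal_gen_mem/gen_w.
by apply/ideal_genD; apply/ideal_genMl/ideal_X.
Qed.

(** Modulo [x] and [y ^+ 2], the norm of z is z^p + C(p + 1, 2) z^(p - 1) y, whose second term
    vanishes in characteristic p. Both chains Z, Y, X and Y, X, 0 are covered. *)
Lemma ideal_orbit_norm x y z :
  Delta_dual A z = y -> Delta_dual A y = x -> Delta_dual A x = 0 ->
  I (linform x) -> I (linform y ^+ 2) -> I (orbit_norm A p (linform z)) ->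
  I (linform z ^+ p).
Proof.
move=> Dz Dy Dx Ix Iyy IN.
have p1 : p.-1.+1 = p by rewrite prednK // prime_gt0.
have := ideal_gen_prod_norm p.-1 (linform z) Ix Iyy.
rewrite p1 (@mulrn_pchar_eq0 _ _ 'C(p.+1, 2)); last first.
  (* Pascal's rule: C(p + 1, 2) = C(p, 2) + p. *)
  by rewrite binS bin1 dvdn_add ?dvdp_bin2.
rewrite addr0; set N := \prod_(_ <= _ < _) _ => IzN.
have NE : N = orbit_norm A p (linform z).
  apply: eq_bigr => k _; rewrite iter_sigma_linform.
  by rewrite (iter_sigma_dual _ Dz Dy Dx) !raddfD !raddfMn.
by rewrite -(subKr N (linform z ^+ p)); apply: ideal_genB => //; rewrite NE.
Qed.

Lemma ideal_Yp i : I (lY (lshift l i) ^+ p).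
Proof.
apply: (ideal_orbit_norm (Delta_Y _) (Delta_X _) Delta_dual0).
- by rewrite raddf0; apply: ideal_gen0.
- by rewrite expr2; apply/ideal_genMl/ideal_X.
- exact/ideal_gen_mem/gen_NY.
Qed.

Lemma ideal_Zp j : I (lZ j ^+ p).
Proof.
apply: (ideal_orbit_norm (Delta_Z _) (Delta_Y _) (Delta_X _)).
- exact: ideal_X.
- by rewrite expr2; apply/ideal_YY.
- exact/ideal_gen_mem/gen_NZ.
Qed.

(** * Invariants without constant term lie in [I] *)

Local Notation T := ('I_(m + l) + ('I_(m + l) + 'I_l))%type.

Definition var (t : T) : 'rV[F]_n :=
  match t with inl i => X i | inr (inl i) => Y i | inr (inr j) => Z j end.

(** The action of Delta on labels, [None] standing for Delta = 0. *)
Definition next (t : T) : option T :=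
  match t with
  | inl _ => None
  | inr (inl i) => Some (inl i)
  | inr (inr j) => Some (inr (inl (rshift m j)))
  end.

(** The labels of the variables killed by kappa. *)
Definition is_next (t : T) : bool :=
  match t with
  | inl _ => true
  | inr (inl i) => (m <= i)%N
  | inr (inr _) => false
  end.

Lemma codom_var : codom var = codom X ++ codom Y ++ codom Z.
Proof. by rewrite !codom_sum. Qed.

Lemma is_next_next t t' : next t = Some t' -> is_next t'.
Proof.
case: t => [i|[i|j]] //= [<-] //=; exact: leq_addr.
Qed.

(** A variable is the shift of at most one other, as the column condition of [subst_fixed_coeff]
    demands. *)
Lemma next_inj t1 t2 t' : next t1 = Some t' -> next t2 = Some t' -> t1 = t2.
Proof.
case: t1 t2 => [i1|[i1|j1]] [i2|[i2|j2]] //= [<-] // [].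
  by move=> ->.
by move/addnI/val_inj => ->.
Qed.

Lemma sigma_dual_var t :
  sigma_dual A (var t) = var t + (if next t is Some t' then var t' else 0).
Proof.
by rewrite sigma_dualE; case: t => [i|[i|j]] /=;
   rewrite ?Delta_X ?Delta_Y ?Delta_Z.
Qed.

(** In the coordinates X, Y, Z, each monomial either lies in [I] or has coefficient 0 by the
    derivative argument. *)
Lemma invariant_in_ideal f : sigma A f = f -> f@_0 = 0 -> I f.
Proof.
move=> sf f0.
have var_basis : basis_of fullv (codom var) by rewrite codom_var.
have [h [h' hK h'K] [E Eu rowE']] := basis_rows_unit var_basis.
(* [g] is [f] and [S] is the matrix of [sigma], both in the coordinates X, Y, Z. *)
pose g := subst (invmx E) f.
pose S := E *m invmx A *m invmx E.
pose K : {pred 'I_n} := [pred k | is_next (h' k)].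
have varE t : var t *m invmx E = delta_mx 0 (h t).
  by rewrite -rowE' -row_mul mulmxV // row1.
have SE t k : S (h t) k = (h t == k)%:R +
    (if next t is Some t' then (h t' == k)%:R else 0).
  have -> : S (h t) k = (row (h t) S) 0 k by rewrite [RHS]mxE.
  rewrite /S !row_mul rowE' -/(sigma_dual A _) sigma_dual_var mulmxDl varE.
  rewrite [LHS]mxE mxE eqxx /= eq_sym; congr (_ + _).
  case: (next t) => [t'|]; last by rewrite mul0mx mxE.
  by rewrite varE mxE eqxx /= eq_sym.
have Sg : subst S g = g.
  rewrite /g subst_subst /S -mulmxA mulKmx // -subst_subst.
  by rewrite -(sigmaE A) sf.
have g0 : g@_0 = 0 by rewrite coeff0_subst.
have fE : f = subst E g by rewrite subst_subst mulVmx // subst1.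
have coeff_g t t' (M : 'X_{1..n}) : next t = Some t' ->
    (forall k, k \in K -> (M - U_(h t))%MM k = 0%N) ->
    (M (h t))%:R != 0 :> F -> g@_M = 0.
  move=> tt'; apply: (@subst_fixed_coeff _ _ S K g (h t) (h t')) => //.
  - move=> k j; rewrite -(h'K k) SE inE => Kj.
    case e: (next _) => [t1|]; last by rewrite addr0.
    case: (h t1 =P j) => [ej|]; last by rewrite addr0.
    by rewrite -ej hK (is_next_next e) in Kj.
  - by rewrite inE hK (is_next_next tt').
  - move=> k; rewrite -(h'K k) SE; congr (_ + _).
    rewrite (can_eq hK).
    case e: (next _) => [t1|]; last first.
      by case: eqP => // et; rewrite et tt' in e.
    rewrite (can_eq hK); congr (_ %:R); congr nat_of_bool.
    apply/eqP/eqP => [et|et]; first by rewrite et in e; apply: next_inj e tt'.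
    by move: e; rewrite et tt' => -[].
have divI N M : (N <= M)%MM -> I (subst E 'X_[N]) -> I (subst E 'X_[M]).
  by move=> /submK <- IN; rewrite mpolyXD substM; apply: ideal_genMl.
have substU t : subst E 'X_(h t) = linform (var t) by rewrite substX rowE'.
have powI t e (M : 'X_{1..n}) : I (linform (var t) ^+ e) -> (e <= M (h t))%N ->
    I (subst E 'X_[M]).
  move=> It eM; apply: (divI (U_(h t) *+ e)%MM).
    apply/mnm_lepP=> i; rewrite mulmnE mnm1E.
    by case: eqP => // <-; rewrite mul1n.
  by rewrite -mpolyXn /subst rmorphXn /= -/(subst E _) substU.
have XI i (M : 'X_{1..n}) : (0 < M (h (inl i)))%N -> I (subst E 'X_[M]).
  by apply: powI; rewrite expr1; apply: ideal_X.
rewrite fE [g in subst E g]mpolyE /subst raddf_sum; apply: ideal_gen_sum => M.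
rewrite mcoeff_msupp /= => gM.
rewrite comp_mpolyZ -/(subst E _) -mul_mpolyC; apply: ideal_genMl.
case: (boolP [exists i, 0 < M (h (inl i))]%N) => [/existsP[i /XI //]|].
rewrite negb_exists => /forallP MX.
case: (boolP [exists i, p <= M (h (inr (inl (lshift l i))))]%N).
  move=> /existsP[i].
  by apply: powI; apply: ideal_Yp.
rewrite negb_exists => /forallP MY.
case: (boolP [exists j, p <= M (h (inr (inr j)))]%N) => [/existsP[j]|].
  by apply: powI; apply: ideal_Zp.
rewrite negb_exists => /forallP MZ.
(* If some Y_j of a V_3 divides M, either M / Y_j avoids [K] and the coefficient vanishes, or Y_j
   Y_k divides M for some k. *)
case: (boolP [exists j, 0 < M (h (inr (inl (rshift m j))))]%N).
  move=> /existsP[j Mj]; set u := h _ in Mj.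
  have le_u : (U_(u) <= M)%MM.
    by apply/mnm_lepP=> i; rewrite mnm1E; case: eqP => // <-.
  case: (boolP [forall k in K, (M - U_(u))%MM k == 0%N]) => [/forall_inP MK|].
    case/eqP: gM; apply: (coeff_g (inr (inl (rshift m j))) _ _ erefl).
      by move=> k /MK /eqP.
    (* Since [u] itself is in [K], its exponent in M is exactly 1, which is nonzero in [F]. *)
    have := MK u; rewrite inE hK /= leq_addr mnmBE mnm1E eqxx => /(_ isT).
    case: (M u) Mj => [//|[|//]] _ _; exact: oner_neq0.
  rewrite negb_forall_in => /exists_inP[k]; rewrite inE -{2}(h'K k) -lt0n.
  case: (h' k) => [i|[i|//]] /= Kk Mk.
    have := MX i; rewrite -leqNgt leqn0 => /eqP M0.
    by rewrite mnmBE M0 in Mk.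
  case: (split_ordP i) Kk Mk => i' ->; first by rewrite leqNgt /= ltn_ord.
  (* The indices may coincide, so divisibility is tested after removing one factor [u]. *)
  move=> _ Mi; apply: (divI (U_(h (inr (inl (rshift m i')))) + U_(u))%MM).
    rewrite -(submK le_u); apply/mnm_lepP=> k'; rewrite !mnmDE leq_add2r mnm1E.
    by case: eqP => // <-.
  by rewrite mpolyXD substM !substU; apply: ideal_YY.
rewrite negb_exists => /forallP MY3.
(* Now M avoids [K]. If M is not 1, it contains a Y_i of a V_2 or a Z_j, with exponent strictly
   between 0 and p, so its coefficient vanishes. *)
have [/eqP M0|] := boolP (M == 0%MM); first by rewrite M0 g0 eqxx in gM.
rewrite -mdeg_eq0 mdegE sum_nat_eq0 negb_forall => /existsP[k] /=.
rewrite -(h'K k) => Mk.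
have MK k' : k' \in K -> M k' = 0%N.
  rewrite inE -{2}(h'K k'); case: (h' k') => [i|[i|//]] /= Kk.
    by apply/eqP; rewrite -leqn0 leqNgt MX.
  case: (split_ordP i) Kk => i' ->; first by rewrite leqNgt /= ltn_ord.
  by move=> _; apply/eqP; rewrite -leqn0 leqNgt MY3.
have [t' tt'] : exists t', next (h' k) = Some t'.
  case: (h' k) Mk => [i|[i|j]] Mk; [|by eexists|by eexists].
  by have := MX i; rewrite lt0n Mk.
case/eqP: gM; apply: (coeff_g _ _ _ tt') => [k' /MK|].
  by rewrite mnmBE => ->.
rewrite -(dvdn_pcharf charF) gtnNdvd ?lt0n // ltnNge.
move: MK Mk; case: (h' k) tt' => [//|[i|j]] _ MK Mk; last exact: MZ.
case: (split_ordP i) Mk => i' -> Mk; first exact: MY.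
by have := MY3 i'; rewrite lt0n Mk.
Qed.

End HilbertIdeal.

(** * The two inclusions, checked on generators *)

Theorem theorem3p5 (p : nat) (F : fieldType) (m l : nat)
  (p_prime : prime p) (p_gt2 : (2 < p)%N) (charF : p \in [pchar F])
  (X Y : 'I_(m + l) -> 'rV[F]_(rep_dim m l))
  (Z : 'I_l -> 'rV[F]_(rep_dim m l))
  (XYZ_basis : basis_of fullv (codom X ++ codom Y ++ codom Z))
  (Delta_Z : forall j : 'I_l, Delta_dual (mV2_lV3 F m l) (Z j) = Y (rshift m j))
  (Delta_Y : forall i : 'I_(m + l), Delta_dual (mV2_lV3 F m l) (Y i) = X i)
  (Delta_X : forall i : 'I_(m + l), Delta_dual (mV2_lV3 F m l) (X i) = 0) :
  forall f : {mpoly F[rep_dim m l]},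
    ideal_gen (generator p (mV2_lV3 F m l)
                 (fun i => linform (X i)) (fun i => linform (Y i))
                 (fun j => linform (Z j))) f
    <-> hilbert_ideal (mV2_lV3 F m l) f.
Proof.
move=> f; split; apply: ideal_gen_sub => g.
  by move/(generator_invariant p_prime p_gt2 charF Delta_Z Delta_Y Delta_X);
    apply: ideal_gen_mem.
case=> g_inv [d [d_gt0 g_homog]].
apply: (invariant_in_ideal p_prime p_gt2 charF XYZ_basis Delta_Z Delta_Y
         Delta_X); first exact: (g_inv 1%N).
(* Homogeneity of positive degree excludes a constant term. *)
by apply: (dhomog_nemf_coeff g_homog); rewrite mf0 eq_sym -lt0n.
Qed.
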